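(* Let $d,n\ge1$, let $A_0,A_1,\dots,A_n\in\mathbb{C}^{d\times d}_{\mathrm{herm}}$, and put $\Phi(S)=\sum_{i=1}^nA_iSA_i$. Consider the primal problem (P) minimize $c$ over $c\in\mathbb{R}$, $Z\in\mathbb{C}^{d\times d}_{\mathrm{herm}}$ subject to $$\begin{bmatrix} cI_d-A_0-Z & A_1&\cdots & A_n\\ A_1 & Z &\cdots & 0\\ \vdots&\vdots&\ddots&\vdots\\ A_n&0&\cdots&Z\end{bmatrix}\succeq 0$$ (all unspecified off-diagonal blocks outside the first block row and column are zero), and the dual problem (D) maximize $$\left\langle \begin{bmatrix} A_0 & -A_1&\cdots&-A_n\\ -A_1&0&\cdots&0\\ \vdots&\vdots&\ddots&\vdots\\ -A_n&0&\cdots&0\end{bmatrix},\ \Gamma\right\rangle$$ over Hermitian block matrices $\Gamma=[\Gamma^{[i,j]}]_{i,j=0}^n\succeq0$ with blocks $\Gamma^{[i,j]}\in\mathbb{C}^{d\times d}$, $(\Gamma^{[i,j]})^*=\Gamma^{[j,i]}$, subject to $\Gamma^{[0,0]}=\sum_{i=1}^n\Gamma^{[i,i]}$ and $\mathrm{Tr}(\Gamma^{[0,0]})=1$. Suppose that the minimum in (P) is achieved by $(c,Z)$ and the maximum in (D) is achieved by $\Gamma$. Then $$(cI_d-A_0-Z)\,\Gamma^{[0,j]}=-\sum_{i=1}^nA_i\Gamma^{[i,j]}\quad\text{for all }0\le j\le n,$$ $$Z\,\Gamma^{[i,j]}=-A_i\Gamma^{[0,j]}\quad\text{for all }1\le i\le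 n,\ 0\le j\le n,$$ $$Z\,\Gamma^{[0,0]}Z=\Phi(\Gamma^{[0,0]}).$$
   Context: $\mathbb{C}^{d\times d}_{\mathrm{herm}}$ is the set of $d\times d$ complex Hermitian matrices; $\succeq$ denotes the Loewner order; $\langle X,Y\rangle=\mathrm{Tr}(X^*Y)$. *)

(* Defs.v *)
From mathcomp Require Import all_boot all_order all_algebra.
From mathcomp Require Import reals.
From mathcomp Require Import complex.

Set Implicit Arguments.
Unset Strict Implicit.
Unset Printing Implicit Defensive.

Import Order.TTheory GRing.Theory Num.Theory.
Local Open Scope ring_scope.
Local Open Scope complex_scope.
Local Open Scope sesquilinear_scope.

(* On R[i] the order is partial: x <= y means that y - x is a nonnegative
   real, so [psdmx M] also says that the quadratic form of M is real-valued. *)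
Definition psdmx (R : realType) (m : nat) (M : 'M[R[i]]_m) : Prop :=
  M \is hermsymmx /\
  forall v : 'cV[R[i]]_m, 0 <= (v ^t* *m M *m v) ord0 ord0.

Definition inner (R : realType) (m : nat) (X Y : 'M[R[i]]_m) : R[i] :=
  \tr (X ^t* *m Y).

Section BlockSDP.

Variables (R : realType) (d n : nat).

(* Square matrices made of (n+1) x (n+1) blocks of size d x d. *)
Definition blockmx : Type := 'M[R[i]]_(\sum_(i < n.+1) d).

Definition blk (G : blockmx) (i j : 'I_n.+1) : 'M[R[i]]_d :=
  @submxblock R[i] n.+1 n.+1 (fun=> d) (fun=> d) G i j.

(* The family A is A_0, ..., A_n; the range 1 <= i <= n is [i != ord0]. *)
Variable A : 'I_n.+1 -> 'M[R[i]]_d.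

Definition Phi (S : 'M[R[i]]_d) : 'M[R[i]]_d :=
  \sum_(i < n.+1 | i != ord0) A i *m S *m A i.

Definition primal_mx (c : R) (Z : 'M[R[i]]_d) : blockmx :=
  \mxblock_(i < n.+1, j < n.+1)
    (if i == ord0 then
       if j == ord0 then (c%:C)%:M - A ord0 - Z else A j
     else
       if j == ord0 then A i else if i == j then Z else 0).

Definition primal_feasible (c : R) (Z : 'M[R[i]]_d) : Prop :=
  Z \is hermsymmx /\ psdmx (primal_mx c Z).

Definition primal_optimal (c : R) (Z : 'M[R[i]]_d) : Prop :=
  primal_feasible c Z /\
  forall (c' : R) (Z' : 'M[R[i]]_d), primal_feasible c' Z' -> c <= c'.

Definition dual_mx : blockmx :=
  \mxblock_(i < n.+1, j < n.+1)
    (if i == ord0 then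
       if j == ord0 then A ord0 else - A j
     else
       if j == ord0 then - A i else 0).

(* The block condition (G^[i,j])^* = G^[j,i] is the Hermitian part of psdmx. *)
Definition dual_feasible (G : blockmx) : Prop :=
  [/\ psdmx G,
      blk G ord0 ord0 = \sum_(i < n.+1 | i != ord0) blk G i i
    & \tr (blk G ord0 ord0) = 1].

(* For Hermitian A_i and G both objective values are real, so the partial
   order of R[i] compares them as real numbers. *)
Definition dual_optimal (G : blockmx) : Prop :=
  dual_feasible G /\
  forall G' : blockmx, dual_feasible G' -> inner dual_mx G' <= inner dual_mx G.

End BlockSDP.

(* Main.v *)
Require Import Defs.
From mathcomp Require Import all_boot all_order all_algebra.
From mathcomp Require Import boolp classical_sets reals.
From mathcomp Require Import complex.
From mathcomp Require Import ring lra.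

(** The theorem is complementary slackness for a pair of dual semidefinite
programs.  Let M be the block matrix of (P) at (c, Z).  For every block matrix
X, the pairing tr(M X) equals c tr(X00) minus the dual objective at X minus
tr(Z E(X)), where E(X) is the difference of X00 and the sum of the other
diagonal blocks ([lagrangian_identity]).  For the dual optimal G this is c minus
the dual value.  If there is no duality gap, then tr(M G) = 0 with M and G both
positive semidefinite, which forces M G = 0 ([psdmx_trace_mul]).  The block rows
of M G = 0 are the first two families of equations, and the third follows by
multiplying the diagonal ones of the second family by Z on the right, replacing
the resulting products of G0i and Z by the adjoints of the second equations,
and summing over i.

The substance is therefore the absence of a gap ([strong_duality]).  Suppose
that the dual value v is smaller than c and choose c' strictly between them.
On the convex set S of positive semidefinite X of trace 1, consider the real
linear map sending X to the pair of E(X) and tau(X), where tau(X) is the dual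
objective minus c' tr(X00).

- The image of S stays away from the origin.  If E(X) is small, adding small
  multiples of the identity to two diagonal blocks, corrected by E(X) in one of
  them, turns X into a rescaled dual feasible point at almost no cost in the
  objective; as the dual optimum is v < c', tau(X) must then be bounded away
  from 0 ([dual_value_perturbation]).

- Hence some w in S has an image of positive inner product with the images of
  all points of S ([exists_separating_point]).  A minimizer of the norm would do;
  an approximate minimizer is enough, so no compactness argument enters.

- Testing against G / 2, whose image is (0, (v - c') / 2), gives tau(w) < 0.
  Testing against rank one matrices then says, after division by tau(w), that
  (c', E(w) / tau(w)) is feasible for (P).  This contradicts the minimality
  of c. *)

Set Implicit Arguments.
Unset Strict Implicit.
Unset Printing Implicit Defensive.

Import Order.TTheory GRing.Theory Num.Theory.
Local Open Scope ring_scope.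
Local Open Scope complex_scope.
Local Open Scope sesquilinear_scope.

(** * Adjoints and traces *)

Section Adjoint.
Variable (C : numClosedFieldType).

Lemma mxtraceB m (A B : 'M[C]_m) : \tr (A - B) = \tr A - \tr B.
Proof. exact: raddfB. Qed.

Lemma mxtrace_sum (I : finType) (P : pred I) m (B : I -> 'M[C]_m) :
  \tr (\sum_(i | P i) B i) = \sum_(i | P i) \tr (B i).
Proof. exact: raddf_sum. Qed.

Lemma adjmxM m n p (A : 'M[C]_(m, n)) (B : 'M[C]_(n, p)) :
  (A *m B)^t* = B^t* *m A^t*.
Proof. by rewrite trmx_mul map_mxM. Qed.

Lemma hermsymmxP m (M : 'M[C]_m) : M \is hermsymmx <-> M^t* = M.
Proof.
split=> [/is_hermitianmxP|hM]; first by rewrite expr0 scale1r => {2}->.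
by apply/is_hermitianmxP; rewrite expr0 scale1r hM.
Qed.

Lemma mxtrace_mul_adjmx m n (L : 'M[C]_(m, n)) :
  \tr (L *m L^t*) = \sum_i \sum_j `|L i j| ^+ 2.
Proof.
apply: eq_bigr => i _; rewrite mxE; apply: eq_bigr => j _.
by rewrite !mxE normCK.
Qed.

Lemma mxtrace_mul_adjmx_ge0 m n (L : 'M[C]_(m, n)) : 0 <= \tr (L *m L^t*).
Proof.
rewrite mxtrace_mul_adjmx.
by apply: sumr_ge0 => i _; apply: sumr_ge0 => j _; rewrite exprn_ge0.
Qed.

Lemma mul_adjmx_eq0 m n (L : 'M[C]_(m, n)) : \tr (L *m L^t*) = 0 -> L = 0.
Proof.
rewrite mxtrace_mul_adjmx => L0; apply/matrixP => i j; rewrite mxE.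
have /psumr_eq0P-/(_ L0 i isT) :
  forall i, true -> 0 <= \sum_j `|L i j| ^+ 2.
  by move=> k _; apply: sumr_ge0 => l _; rewrite exprn_ge0.
move=> Li0.
have /psumr_eq0P-/(_ Li0 j isT)/eqP : forall j, true -> 0 <= `|L i j| ^+ 2.
  by move=> k _; rewrite exprn_ge0.
by rewrite expf_eq0 /= normr_eq0 => /eqP.
Qed.

(** Cauchy-Schwarz for the rows of L, in the weak form
2 |x y| <= |x|^2 + |y|^2. *)
Lemma mul_adjmx_entry_le m n (L : 'M[C]_(m, n)) i j :
  `|(L *m L^t*) i j| <= \tr (L *m L^t*).
Proof.
have row_le k : \sum_l `|L k l| ^+ 2 <= \tr (L *m L^t*).
  rewrite mxtrace_mul_adjmx (bigD1 k) //= lerDl.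
  by apply: sumr_ge0 => l _; apply: sumr_ge0 => q _; rewrite exprn_ge0.
have le2 : `|(L *m L^t*) i j| *+ 2 <= \tr (L *m L^t*) *+ 2.
  rewrite [leRHS]mulr2n; apply: le_trans (lerD (row_le i) (row_le j)).
  rewrite -big_split /= mxE -mulr_natr.
  apply: le_trans (ler_wpM2r _ (ler_norm_sum _ _ _)) _ => //.
  rewrite mulr_suml; apply: ler_sum => k _.
  rewrite !mxE normrM norm_conjC -subr_ge0.
  have -> : `|L i k| ^+ 2 + `|L j k| ^+ 2 - `|L i k| * `|L j k| * 2 =
    (`|L i k| - `|L j k|) ^+ 2 by ring.
  by rewrite real_exprn_even_ge0 // realB ?normr_real.
by rewrite lerMn2r in le2.
Qed.

Lemma mxtrace_herm_real m (A B : 'M[C]_m) :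
  A \is hermsymmx -> B \is hermsymmx -> \tr (A *m B) \is Num.real.
Proof.
move=> /hermsymmxP hA /hermsymmxP hB; apply/CrealP.
by rewrite -trace_map_mx -mxtrace_tr map_trmx adjmxM hA hB mxtrace_mulC.
Qed.
End Adjoint.

(** * Positive semidefinite matrices *)

Section Psd.
Variable (R : realType).
Local Notation C := R[i].

Lemma psdmx_mul_adj m n (L : 'M[C]_(m, n)) : psdmx (L *m L^t*).
Proof.
split=> [|v]; first by apply/hermsymmxP; rewrite adjmxM trmxCK.
have -> : v^t* *m (L *m L^t*) *m v = (v^t* *m L) *m (v^t* *m L)^t*.
  by rewrite adjmxM trmxCK !mulmxA.
by rewrite -trace_mx11 mxtrace_mul_adjmx_ge0.
Qed.

(** In a spectral decomposition the eigenvalues are values of the quadratic form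
at the eigenvectors, so they are nonnegative and have square roots. *)
Lemma psdmx_factor m (M : 'M[C]_m) : psdmx M -> exists L : 'M[C]_m, M = L *m L^t*.
Proof.
move=> [hM pM]; set P := spectralmx M; set s := spectral_diag M.
have uP : P \is unitarymx := spectral_unitarymx M.
have eM : M = P^t* *m diag_mx s *m P.
  by rewrite -invmx_unitary //; apply/orthomx_spectralP/hermitian_normalmx.
have PPt : P *m P^t* = 1%:M by apply/unitarymxP.
have s_ge0 k : 0 <= s 0 k.
  have := pM ((row k P)^t*); rewrite trmxCK {1}eM !mulmxA -row_mul PPt.
  rewrite -mulmxA (_ : P *m _ = (row k 1%:M)^t*).
    by rewrite row1 -rowE trmx_delta map_delta_mx -colE !mxE eqxx mulr1n.
  by rewrite -[LHS]trmxCK adjmxM trmxCK -row_mul PPt.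
exists (P^t* *m diag_mx (\row_k sqrtC (s 0 k))).
rewrite adjmxM trmxCK tr_diag_mx map_diag_mx !mulmxA eM.
rewrite -[in RHS](mulmxA (P^t*)) mulmx_diag; congr (_ *m diag_mx _ *m _).
apply/rowP => k; rewrite !mxE.
by rewrite /= conj_Creal -?expr2 ?sqrtCK // ger0_real ?sqrtC_ge0.
Qed.

(** With M and N factored as K and L times their adjoints, tr(M N) is the squared
Frobenius norm of the product of the adjoint of K with L, and that product is
the middle part of M N. *)
Lemma psdmx_trace_mul m (M N : 'M[C]_m) : psdmx M -> psdmx N ->
  0 <= \tr (M *m N) /\ (\tr (M *m N) = 0 -> M *m N = 0).
Proof.
move=> /psdmx_factor[K ->] /psdmx_factor[L ->].
have -> : \tr (K *m K^t* *m (L *m L^t*)) = \tr ((K^t* *m L) *m (K^t* *m L)^t*).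
  by rewrite adjmxM trmxCK -mulmxA mxtrace_mulC !mulmxA.
split=> [|/mul_adjmx_eq0 KL0]; first exact: mxtrace_mul_adjmx_ge0.
by rewrite -mulmxA (mulmxA (K^t*)) KL0 mul0mx mulmx0.
Qed.

Lemma psdmxD m (M N : 'M[C]_m) : psdmx M -> psdmx N -> psdmx (M + N).
Proof.
move=> [/hermsymmxP hM pM] [/hermsymmxP hN pN]; split=> [|v].
  by apply/hermsymmxP; rewrite linearD /= map_mxD hM hN.
by rewrite mulmxDr mulmxDl mxE addr_ge0.
Qed.

Lemma psdmxZ m (a : R) (M : 'M[C]_m) : 0 <= a -> psdmx M -> psdmx (a%:C *: M).
Proof.
move=> a0 [/hermsymmxP hM pM]; split=> [|v].
  by apply/hermsymmxP; rewrite linearZ /= map_mxZ hM /= conj_Creal // complex_real.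
by rewrite -scalemxAr -scalemxAl mxE mulr_ge0 ?ler0c.
Qed.

Lemma psdmx_scalar m (a : R) : 0 <= a -> psdmx (a%:C%:M : 'M[C]_m).
Proof.
move=> a0; rewrite -scalemx1; apply: psdmxZ => //.
by have := psdmx_mul_adj (1%:M : 'M[C]_m); rewrite trmx1 map_mx1 mulmx1.
Qed.

Lemma psdmx_trace_ge0 m (M : 'M[C]_m) : psdmx M -> 0 <= \tr M.
Proof. by move=> /psdmx_factor[L ->]; apply: mxtrace_mul_adjmx_ge0. Qed.

Definition entry_norm1 m n (B : 'M[C]_(m, n)) : C := \sum_i \sum_j `|B i j|.

Lemma psdmx_entry_le m (X : 'M[C]_m) i j : psdmx X -> `|X i j| <= \tr X.
Proof. by move=> /psdmx_factor[L ->]; apply: mul_adjmx_entry_le. Qed.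

(** Duality of the entrywise 1-norm and the maximum norm: the trace of a positive
semidefinite matrix bounds each of its entries. *)
Lemma psdmx_trace_bound m (B X : 'M[C]_m) : psdmx X ->
  `|\tr (B *m X)| <= entry_norm1 B * \tr X.
Proof.
move=> pX; apply: le_trans (ler_norm_sum _ _ _) _.
rewrite mulr_suml; apply: ler_sum => i _; rewrite mxE mulr_suml.
apply: le_trans (ler_norm_sum _ _ _) _; apply: ler_sum => j _.
by rewrite normrM ler_wpM2l ?normr_ge0 ?psdmx_entry_le.
Qed.

Lemma quadratic_form_trace m (M : 'M[C]_m) (v : 'cV_m) :
  (v^t* *m M *m v) ord0 ord0 = \tr (M *m (v *m v^t*)).
Proof. by rewrite -trace_mx11 -mulmxA mxtrace_mulC mulmxA. Qed.

Lemma entry_norm1_ge0 m n (B : 'M[C]_(m, n)) : 0 <= entry_norm1 B.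
Proof. by apply: sumr_ge0 => i _; apply: sumr_ge0 => j _; rewrite normr_ge0. Qed.

(** The quadratic form of E at v is the pairing of E with the rank one matrix of v,
so it is at least minus the entrywise 1-norm of E times the squared norm of v. *)
Lemma psdmx_shift m (E : 'M[C]_m) (e : C) : E \is hermsymmx ->
  entry_norm1 E <= e -> psdmx (e%:M + E).
Proof.
move=> /hermsymmxP hE le_e.
have e0 := le_trans (entry_norm1_ge0 E) le_e.
split=> [|v].
  apply/hermsymmxP; rewrite linearD /= map_mxD hE tr_scalar_mx map_scalar_mx.
  by rewrite /= conj_Creal // ger0_real.
have pv := psdmx_mul_adj v.
have v0 := mxtrace_mul_adjmx_ge0 v.
rewrite quadratic_form_trace mulmxDl mul_scalar_mx linearD linearZ /=.
have hv : v *m v^t* \is hermsymmx by case: pv.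
have := psdmx_trace_bound E pv.
rewrite real_ler_norml ?mxtrace_herm_real //; last by apply/hermsymmxP.
case/andP=> [le_tr _]; rewrite -[leLHS](addNr (e * \tr (v *m v^t*))).
by rewrite addrC lerD2l; apply: le_trans le_tr; rewrite lerN2 ler_wpM2r.
Qed.

Lemma sum_sum_constC m n (a : R) :
  \sum_(i < m) \sum_(j < n) a%:C = (m%:R * n%:R * a)%:C.
Proof.
by rewrite !sumr_const !card_ord -!rmorphMn /= -mulrA !mulr_natl.
Qed.

Lemma entry_norm1_le m n (B : 'M[C]_(m, n)) (a : R) : 0 <= a ->
  \tr (B *m B^t*) <= (a ^+ 2)%:C -> entry_norm1 B <= (m%:R * n%:R * a)%:C.
Proof.
move=> a0 trB.
have B_le i j : `|B i j| <= a%:C.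
  have sq_le : `|B i j| ^+ 2 <= a%:C ^+ 2.
    rewrite -[leRHS]rmorphXn; apply: le_trans _ trB.
    rewrite mxtrace_mul_adjmx.
    rewrite (bigD1 i) //= (bigD1 j) //= -addrA lerDl addr_ge0 //.
      by apply: sumr_ge0 => l _; rewrite exprn_ge0.
    by apply: sumr_ge0 => l _; apply: sumr_ge0 => q _; rewrite exprn_ge0.
  have a0' : 0 <= a%:C by rewrite ler0c.
  by rewrite ler_pXn2r ?nnegrE // in sq_le.
apply: (@le_trans _ _ (\sum_(i < m) \sum_(j < n) a%:C)).
  by apply: ler_sum => i _; apply: ler_sum => j _; apply: B_le.
by rewrite sum_sum_constC.
Qed.
End Psd.

(** * Separating a convex set from the origin *)

(** A bounded convex set at positive distance from the origin lies in an open half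
space whose boundary passes through the origin.  An exact minimizer w of the
norm would satisfy b w x >= b w w on the set; for an approximate minimizer this
degrades only to positivity, because a point x with b w x <= 0 would make the
points of the segment from w to x near w too short.  Boundedness controls the
second order term along the segment uniformly. *)
Lemma exists_separating_point (R : realType) (V : lmodType R[i])
    (b : V -> V -> R) (S : V -> Prop) (K delta : R) :
  (forall x y, b x y = b y x) ->
  (forall x y z, b (x + y) z = b x z + b y z) ->
  (forall (a : R) x y, b (a%:C *: x) y = a * b x y) ->
  (forall x y (s : R), 0 <= s <= 1 -> S x -> S y ->
     S ((1 - s)%:C *: x + s%:C *: y)) ->
  (exists x, S x) ->
  0 < delta -> (forall x, S x -> delta <= b x x <= K) ->
  exists w, S w /\ forall x, S x -> 0 < b w x.
Proof.
move=> bC bD bZ Sconv [x0 Sx0] d0 bS.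
pose N : set R := fun r => exists2 x, S x & r = b x x.
have N_inf : has_inf N.
  split; first by exists (b x0 x0), x0.
  by exists delta => _ [x Sx ->]; case/andP: (bS x Sx).
have m_ge : delta <= inf N.
  apply: lb_le_inf; first by exists (b x0 x0), x0.
  by move=> _ [x Sx ->]; case/andP: (bS x Sx).
set m := inf N in m_ge.
have m_le x : S x -> m <= b x x.
  by move=> Sx; apply: ge_inf; [case: N_inf | exists x].
have K_ge : m <= K by apply: le_trans (m_le _ Sx0) _; case/andP: (bS x0 Sx0).
have m0 : 0 < m by lra.
have e0 : 0 < m ^+ 2 / (m + K) by apply: divr_gt0; [rewrite exprn_gt0|lra].
have [_ [w Sw ->] w_lt] := inf_adherent e0 N_inf.
exists w; split=> // x Sx; rewrite ltNge; apply/negP => b_le0.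
(* The step s minimizes (1 - s)^2 m + s^2 K, the squared norm along the segment
   in the worst case where b w w = m, b w x = 0 and b x x = K. *)
set s := m / (m + K).
have s0 : 0 < s by rewrite /s divr_gt0 //; lra.
have s1 : s <= 1 by rewrite /s ler_pdivrMr; lra.
have := m_le _ (Sconv w x s _ Sw Sx); rewrite ltW // s1 => /(_ isT).
rewrite bD !bZ ![b _ (_ + _)]bC !bD !bZ (bC x w).
have /andP[_ xK] := bS x Sx.
have sE : s * (m + K) = m by rewrite /s; field; lra.
have eE : m ^+ 2 / (m + K) = s * m by rewrite /s; field; lra.
rewrite eE -/m in w_lt => ineq; clearbody s.
have cross : s * (1 - s) * b w x <= 0.
  by rewrite mulr_ge0_le0 // mulr_ge0 ?subr_ge0 // ltW.
have far : s * s * b x x <= s * m * (1 - s).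
  have sK : s * K = m * (1 - s) by lra.
  have -> : s * m * (1 - s) = s * s * K by rewrite -(mulrA s s K) sK mulrA.
  by rewrite ler_wpM2l // mulr_ge0 // ltW.
have near : (1 - s) * (1 - s) * b w w <= (1 - s) * (1 - s) * (m + s * m).
  by rewrite ler_wpM2l ?mulr_ge0 ?subr_ge0 // ltW.
(* (1 - s)^2 m (1 + s) + s m (1 - s) = m - m s^2 (2 - s) < m. *)
have gain : 0 < m * (s * s) * (2 - s) by rewrite !mulr_gt0 //; lra.
lra.
Qed.

(** * Block matrices and the Lagrangian *)

Section Blocks.
Variables (R : realType) (d n : nat).
Local Notation C := R[i].
Implicit Types X Y : blockmx R d n.

Lemma blkD X Y i j : blk (X + Y) i j = blk X i j + blk Y i j.
Proof. exact: submxblockD. Qed.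

Lemma blkZ (a : C) X i j : blk (a *: X : blockmx R d n) i j = a *: blk X i j.
Proof. by apply/matrixP => u v; rewrite !mxE. Qed.

Lemma blkM X Y i j : blk (X *m Y) i j = \sum_k blk X i k *m blk Y k j.
Proof.
rewrite -{1}(submxblockK X) -{1}(submxblockK Y) mul_mxblock.
exact: mxblockK.
Qed.

Lemma blk_adj X i j : blk (X^t*) i j = (blk X j i)^t*.
Proof. by apply/matrixP => u v; rewrite !mxE. Qed.

Lemma blkP X Y : (forall i j, blk X i j = blk Y i j) -> X = Y.
Proof. by move=> e; apply/mxblockP. Qed.

Lemma mxtrace_blk X : \tr X = \sum_i \tr (blk X i i).
Proof. by rewrite -{1}(submxblockK X) mxtrace_mxblock. Qed.

Definition embed (k : 'I_n.+1) (P : 'M[C]_d) : blockmx R d n :=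
  \mxblock_(i < n.+1, j < n.+1) (if (i == k) && (j == k) then P else 0).

Lemma blk_embed k P i j :
  blk (embed k P) i j = if (i == k) && (j == k) then P else 0.
Proof. exact: mxblockK. Qed.

Lemma psdmx_embed k P : psdmx P -> psdmx (embed k P).
Proof.
move=> /psdmx_factor[L ->].
suff -> : embed k (L *m L^t*) =
    (\mxcol_(i < n.+1) (if i == k then L else 0)) *m
    (\mxcol_(i < n.+1) (if i == k then L else 0))^t*.
  exact: psdmx_mul_adj.
have -> : (\mxcol_(i < n.+1) (if i == k then L else 0))^t* =
    \mxrow_(i < n.+1) (if i == k then L^t* else 0).
  apply/matrixP => u v; rewrite !mxE.
  by case: ifP => _; rewrite !mxE ?conjC0.
rewrite mul_mxcol_mxrow; apply: eq_mxblock => i j.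
by case: eqP => _; case: eqP => _; rewrite /= ?mul0mx ?mulmx0.
Qed.

Lemma mxtrace_embed k P X : \tr (X *m embed k P) = \tr (P *m blk X k k).
Proof.
rewrite mxtrace_mulC.
rewrite mxtrace_blk (bigD1 k) //= [X in _ + X]big1 => [|i /negPf ik]; last first.
  by rewrite blkM big1 ?mxtrace0 // => j _; rewrite blk_embed ik mul0mx.
rewrite addr0 blkM (bigD1 k) //= [X in \tr (_ + X)]big1 => [|j /negPf jk].
  by rewrite blk_embed eqxx addr0.
by rewrite blk_embed jk andbF mul0mx.
Qed.

(** The linear equality constraint of the dual problem says that this vanishes. *)
Definition diag_defect X : 'M[C]_d :=
  blk X ord0 ord0 - \sum_(i < n.+1 | i != ord0) blk X i i.

Lemma diag_defectD X Y : diag_defect (X + Y) = diag_defect X + diag_defect Y.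
Proof.
rewrite /diag_defect blkD (eq_bigr _ (fun i _ => blkD X Y i i)) big_split /=.
by rewrite opprD addrACA.
Qed.

Lemma diag_defectZ (a : C) X :
  diag_defect (a *: X : blockmx R d n) = a *: diag_defect X.
Proof.
rewrite /diag_defect blkZ (eq_bigr _ (fun i _ => blkZ a X i i)).
by rewrite -scaler_sumr scalerBr.
Qed.

Lemma diag_defect_entry_le X u v : psdmx X ->
  `|diag_defect X u v| <= n.+1%:R * \tr X.
Proof.
move=> pX; have blk_le i : `|blk X i i u v| <= \tr X.
  by rewrite /blk /submxblock mxE; apply: psdmx_entry_le.
apply: (@le_trans _ _ (\sum_(i < n.+1) `|blk X i i u v|)).
  rewrite (bigD1 ord0) //= /diag_defect mxE [X in _ + X]mxE summxE.
  apply: le_trans (ler_normB _ _) _.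
  by rewrite lerD2l; apply: ler_norm_sum.
apply: (@le_trans _ _ (\sum_(i < n.+1) \tr X)); first exact: ler_sum.
by rewrite sumr_const card_ord mulr_natl.
Qed.

Lemma diag_defect_herm X : X \is hermsymmx -> diag_defect X \is hermsymmx.
Proof.
move=> /hermsymmxP hX; apply/hermsymmxP.
have hb i : (blk X i i)^t* = blk X i i by rewrite -blk_adj hX.
rewrite /diag_defect linearB /= map_mxB hb linear_sum /= map_mx_sum.
by congr (_ - _); apply: eq_bigr.
Qed.

Lemma diag_defect_embed0 P : diag_defect (embed ord0 P) = P.
Proof.
rewrite /diag_defect blk_embed big1 ?subr0 // => i /negPf i0.
by rewrite blk_embed i0.
Qed.

Lemma diag_defect_embed k P : k != ord0 -> diag_defect (embed k P) = - P.
Proof.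
move=> k0; rewrite /diag_defect blk_embed eq_sym (negPf k0) sub0r.
rewrite (bigD1 k) //= blk_embed eqxx big1 ?addr0 // => i /andP[_ /negPf ik].
by rewrite blk_embed ik.
Qed.

Lemma diag_defect_trace X :
  \tr X = \tr (blk X ord0 ord0) *+ 2 - \tr (diag_defect X).
Proof.
rewrite mxtrace_blk (bigD1 ord0) //= /diag_defect mxtraceB mxtrace_sum.
by rewrite opprB mulr2n addrCA addrK addrC.
Qed.

Variable A : 'I_n.+1 -> 'M[C]_d.
Hypothesis hA : forall i, A i \is hermsymmx.

Lemma blk_primal_mx c Z i j : blk (primal_mx A c Z) i j =
  if i == ord0 then if j == ord0 then c%:C%:M - A ord0 - Z else A j
  else if j == ord0 then A i else if i == j then Z else 0.
Proof. exact: mxblockK. Qed.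

Lemma blk_dual_mx i j : blk (dual_mx A) i j =
  if i == ord0 then if j == ord0 then A ord0 else - A j
  else if j == ord0 then - A i else 0.
Proof. exact: mxblockK. Qed.

Lemma primal_mx_herm c Z : Z \is hermsymmx -> primal_mx A c Z \is hermsymmx.
Proof.
move=> /hermsymmxP hZ; apply/hermsymmxP/blkP => i j.
have hA' k : (A k)^t* = A k by apply/hermsymmxP.
rewrite blk_adj !blk_primal_mx (eq_sym j i).
case: (i =P ord0) => [_|_]; case: (j =P ord0) => [_|_] //.
  rewrite !linearB /= !map_mxB hZ hA' tr_scalar_mx map_scalar_mx /=.
  by rewrite conj_Creal // complex_real.
by case: ifP => _; rewrite ?hZ // linear0 map_mx0.
Qed.

Lemma dual_mx_herm : dual_mx A \is hermsymmx.
Proof.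
apply/hermsymmxP/blkP => i j.
have hA' k : (A k)^t* = A k by apply/hermsymmxP.
rewrite blk_adj !blk_dual_mx.
case: (i =P ord0) => [_|_]; case: (j =P ord0) => [_|_] //;
  by rewrite ?linearN /= ?map_mxN ?hA' // linear0 map_mx0.
Qed.

Lemma inner_herm m (M X : 'M[C]_m) : M \is hermsymmx -> inner M X = \tr (M *m X).
Proof. by move=> /hermsymmxP hM; rewrite /inner hM. Qed.

(** The Lagrangian of the two problems.  Adding the dual matrix to the primal one
cancels the A_i and leaves a block diagonal matrix. *)
Lemma lagrangian_identity (c : R) Z X :
  \tr (primal_mx A c Z *m X) =
  c%:C * \tr (blk X ord0 ord0) - \tr (dual_mx A *m X) - \tr (Z *m diag_defect X).
Proof.
apply/eqP; rewrite addrAC -subr_eq opprK; apply/eqP.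
rewrite -mxtraceD -mulmxDl mxtrace_blk.
have sumE i j : blk (primal_mx A c Z + dual_mx A) i j =
    if i == j then (if i == ord0 then c%:C%:M - Z else Z) else 0.
  rewrite blkD blk_primal_mx blk_dual_mx.
  case: (i =P ord0) => [->|/eqP i0]; case: (j =P ord0) => [->|/eqP j0].
  - by rewrite eqxx addrAC subrK.
  - by rewrite subrr eq_sym (negPf j0).
  - by rewrite subrr (negPf i0).
  - by rewrite addr0.
transitivity (\sum_(i < n.+1)
    \tr ((if i == ord0 then c%:C%:M - Z else Z) *m blk X i i)).
  apply: eq_bigr => i _; rewrite blkM (bigD1 i) //= [X in \tr (_ + X)]big1 => [|j ji].
    by rewrite sumE eqxx addr0.
  by rewrite sumE eq_sym (negPf ji) mul0mx.
rewrite (bigD1 ord0) //= (eq_bigr (fun i => \tr (Z *m blk X i i))); last first.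
  by move=> i /negPf ->.
rewrite /diag_defect mulmxBl mulmxBr mul_scalar_mx mulmx_sumr !mxtraceB mxtrace_sum.
by rewrite mxtraceZ opprB addrA addrAC.
Qed.
End Blocks.

(** * Real parts and the real Hilbert-Schmidt inner product *)

Section RealParts.
Variable (R : realType).
Local Notation C := R[i].
Local Notation re := (@complex.Re R).

Lemma ReD (x y : C) : re (x + y) = re x + re y.
Proof. by case: x y => [? ?] []. Qed.

Lemma ReN (x : C) : re (- x) = - re x.
Proof. by case: x. Qed.

Lemma ReZ (a : R) (x : C) : re (a%:C * x) = a * re x.
Proof. by case: x => u w /=; rewrite mul0r subr0. Qed.

Lemma le_Re (x y : C) : x <= y -> re x <= re y.
Proof. by rewrite lecE => /andP[]. Qed.

Lemma Re_conj (x : C) : re (x^*)%R = re x.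
Proof. by case: x. Qed.

Lemma normr_Re_le (x : C) (a : R) : `|x| <= a%:C -> `|re x| <= a.
Proof. by move=> h; rewrite -lecR (le_trans (normc_ge_Re x)). Qed.

Definition re_hs m (P Q : 'M[C]_m) : R := re (\tr (P^t* *m Q)).

Lemma re_hsC m (P Q : 'M[C]_m) : re_hs P Q = re_hs Q P.
Proof.
rewrite /re_hs -Re_conj -trace_map_mx -mxtrace_tr map_trmx.
by rewrite adjmxM trmxCK.
Qed.

Lemma re_hs0 m (Q : 'M[C]_m) : re_hs 0 Q = 0.
Proof. by rewrite /re_hs linear0 map_mx0 mul0mx mxtrace0. Qed.

Lemma re_hsD m (P Q S : 'M[C]_m) : re_hs (P + Q) S = re_hs P S + re_hs Q S.
Proof. by rewrite /re_hs linearD /= map_mxD mulmxDl mxtraceD ReD. Qed.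

Lemma re_hsZ m (a : R) (P Q : 'M[C]_m) : re_hs (a%:C *: P) Q = a * re_hs P Q.
Proof.
rewrite /re_hs linearZ /= map_mxZ -scalemxAl mxtraceZ /=.
by rewrite conj_Creal ?complex_real // ReZ.
Qed.

Lemma re_hs_mxE m (P : 'M[C]_m) : (re_hs P P)%:C = \tr (P *m P^t*).
Proof.
rewrite /re_hs mxtrace_mulC RRe_real // ger0_real //.
exact: mxtrace_mul_adjmx_ge0.
Qed.

Lemma re_hs_ge0 m (P : 'M[C]_m) : 0 <= re_hs P P.
Proof. by rewrite -ler0c re_hs_mxE mxtrace_mul_adjmx_ge0. Qed.

Lemma re_hs_le m (P : 'M[C]_m) (a : R) : (forall i j, `|P i j| <= a%:C) ->
  re_hs P P <= m%:R * m%:R * a ^+ 2.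
Proof.
move=> P_le; rewrite -lecR re_hs_mxE mxtrace_mul_adjmx.
apply: (@le_trans _ _ (\sum_(i < m) \sum_(j < m) a%:C ^+ 2)).
  apply: ler_sum => i _; apply: ler_sum => j _.
  by rewrite ler_pXn2r ?nnegrE //; apply: le_trans (P_le i j).
by rewrite -rmorphXn sum_sum_constC.
Qed.

End RealParts.

(** * Absence of a duality gap *)

Section Gap.
Variables (R : realType) (d n : nat).
Local Notation C := R[i].
Local Notation re := (@complex.Re R).
Implicit Types X Y : blockmx R d n.

Variable A : 'I_n.+1 -> 'M[C]_d.
Hypothesis hA : forall i, A i \is hermsymmx.

(** Dual optimality in homogeneous form: the normalization of the trace is replaced
by a comparison of the objective with v tr(X00), where v is the optimal value. *)
Lemma dual_optimal_homogeneous G X : dual_optimal A G ->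
  psdmx X -> diag_defect X = 0 -> 0 < re (\tr (blk X ord0 ord0)) ->
  re (\tr (dual_mx A *m X)) <=
    re (\tr (dual_mx A *m G)) * re (\tr (blk X ord0 ord0)).
Proof.
move=> [_ Gmax] pX X0; set t := re _ => t0.
have tE : \tr (blk X ord0 ord0) = t%:C.
  rewrite /t RRe_real //; have := diag_defect_trace X.
  rewrite X0 mxtrace0 subr0 -mulr_natl => trX.
  have -> : \tr (blk X ord0 ord0) = 2^-1 * \tr X by rewrite trX mulKf ?pnatr_eq0.
  by rewrite ger0_real // mulr_ge0 ?invr_ge0 ?ler0n //; exact: psdmx_trace_ge0.
have /Gmax : dual_feasible (t^-1%:C *: X : blockmx R d n).
  split; first by apply: psdmxZ => //; rewrite invr_ge0 ltW.
    by apply: subr0_eq; rewrite -[LHS]/(diag_defect _) diag_defectZ X0 scaler0.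
  by rewrite blkZ mxtraceZ tE -rmorphM mulVf // gt_eqF.
rewrite !inner_herm ?dual_mx_herm // -scalemxAr mxtraceZ => /le_Re.
by rewrite ReZ mulrC ler_pdivrMr.
Qed.

(** An X of trace 1 that violates the equality constraint by at most e has dual
objective at most c' tr(X00) - (c' - v) / 2 + O(e).  Adding e I to the block
(0, 0) and e I + E(X) to the block (k, k) keeps X positive semidefinite and
restores the constraint; it changes the objective by a multiple of e, and the
corrected matrix still has trace at least 1, half of it in the block (0, 0). *)
Lemma dual_value_perturbation G (c' : R) (k : 'I_n.+1) : k != ord0 ->
  dual_optimal A G -> re (\tr (dual_mx A *m G)) <= c' ->
  exists2 M : R, 0 <= M & forall X (e : R), psdmx X -> \tr X = 1 ->
    entry_norm1 (diag_defect X) <= e%:C ->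
    (c' - re (\tr (dual_mx A *m G))) / 2 <=
    - re (\tr (dual_mx A *m X) - c'%:C * \tr (blk X ord0 ord0)) + e * M.
Proof.
move=> k0 hG; set v := re _ => v_le.
pose m := re (\tr (A ord0) - c'%:C * d%:R); exists `|m| => // X e pX trX le_e.
set E := diag_defect X in le_e.
have hE : E \is hermsymmx by apply: diag_defect_herm; case: pX.
have e0 : 0 <= e by rewrite -ler0c; apply: le_trans (entry_norm1_ge0 E) le_e.
pose P0 : 'M[C]_d := e%:C%:M; pose P1 := P0 + E.
have pP0 : psdmx P0 by apply: psdmx_scalar.
have pP1 : psdmx P1 by apply: psdmx_shift.
pose Y : blockmx R d n := X + embed ord0 P0 + embed k P1.
have pY : psdmx Y by apply: psdmxD (psdmxD pX _) _; apply: psdmx_embed.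
have Y0 : diag_defect Y = 0.
  rewrite !diag_defectD diag_defect_embed0 diag_defect_embed //.
  by rewrite /P1 -/E (addrC P0) subrr.
have tE : blk Y ord0 ord0 = blk X ord0 ord0 + P0.
  by rewrite !blkD !blk_embed eqxx eq_sym (negPf k0) addr0.
have trY : \tr (dual_mx A *m Y) = \tr (dual_mx A *m X) + e%:C * \tr (A ord0).
  rewrite !mulmxDr !mxtraceD !mxtrace_embed.
  rewrite !blk_dual_mx eqxx (negPf k0) mulmx0 mxtrace0 addr0.
  by rewrite mul_scalar_mx mxtraceZ.
have tY : \tr (blk Y ord0 ord0) = \tr (blk X ord0 ord0) + e%:C * d%:R.
  by rewrite tE mxtraceD /P0 mxtrace_scalar mulr_natr.
have tY_ge : 2^-1 <= re (\tr (blk Y ord0 ord0)).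
  have trYE := diag_defect_trace Y; rewrite Y0 mxtrace0 subr0 in trYE.
  have : 1 <= \tr Y.
    rewrite /Y !mxtraceD trX -addrA lerDl; apply: addr_ge0.
      exact: psdmx_trace_ge0 (psdmx_embed _ pP0).
    exact: psdmx_trace_ge0 (psdmx_embed _ pP1).
  by rewrite trYE mulr2n => /le_Re; rewrite ReD /=; set y := re _ => ?; lra.
have tY_gt : 0 < re (\tr (blk Y ord0 ord0)).
  by apply: lt_le_trans tY_ge; rewrite invr_gt0 ltr0n.
have := dual_optimal_homogeneous hG pY Y0 tY_gt.
have natC : d%:R = (d%:R : R)%:C by rewrite rmorph_nat.
have mE : m = re (\tr (A ord0)) - c' * d%:R by rewrite /m natC ReD ReN ReZ.
have em : - (e * m) <= e * `|m|.
  by rewrite -mulrN ler_wpM2l // -normrN ler_norm.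
rewrite -/v trY tY natC !ReD ReN !ReZ -/v.
rewrite tY natC ReD ReZ /= in tY_ge; rewrite mE in em *.
set t := re (\tr (A ord0)) in em *; set x := re (\tr (blk X _ _)) in tY_ge *.
move=> opt; have : (c' - v) / 2 <= (c' - v) * (x + e * d%:R).
  by rewrite ler_wpM2l // subr_ge0.
lra.
Qed.

(** If the dual value were below c, a real c' in between would be the first
component of a primal feasible point, namely the one obtained from a point w
separating the pairs (E(X), tau(X)) from the origin. *)
Theorem strong_duality (c : R) Z G : (0 < n)%N ->
  primal_optimal A c Z -> dual_optimal A G -> c <= re (\tr (dual_mx A *m G)).
Proof.
move=> n0 [_ cmin] hG; rewrite leNgt; apply/negP; set v := re _ => v_lt.
have k0 : (lift ord0 (Ordinal n0) : 'I_n.+1) != ord0 by rewrite eq_sym neq_lift.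
pose c' := (v + c) / 2.
have vc' : v < c' by rewrite /c'; lra.
have c'c : c' < c by rewrite /c'; lra.
pose D : blockmx R d n := dual_mx A - embed ord0 (c'%:C%:M).
have DE X : \tr (D *m X) = \tr (dual_mx A *m X) - c'%:C * \tr (blk X ord0 ord0).
  rewrite /D mulmxBl mxtraceB [X in _ - X]mxtrace_mulC mxtrace_embed.
  by rewrite mul_scalar_mx mxtraceZ.
pose tau X := re (\tr (D *m X)).
have tauD X Y : tau (X + Y) = tau X + tau Y by rewrite /tau mulmxDr mxtraceD ReD.
have tauZ (a : R) X : tau (a%:C *: X) = a * tau X.
  by rewrite /tau -scalemxAr mxtraceZ ReZ.
pose b X Y := re_hs (diag_defect X) (diag_defect Y) + tau X * tau Y.
pose S X := psdmx X /\ \tr X = 1.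
have bC X Y : b X Y = b Y X by rewrite /b re_hsC (mulrC (tau X)).
have bD X Y W : b (X + Y) W = b X W + b Y W.
  by rewrite /b diag_defectD re_hsD tauD mulrDl addrACA.
have bZ (a : R) X Y : b (a%:C *: X) Y = a * b X Y.
  by rewrite /b diag_defectZ re_hsZ tauZ mulrDr mulrA.
have Sconv X Y (s : R) : 0 <= s <= 1 -> S X -> S Y ->
    S ((1 - s)%:C *: X + s%:C *: Y).
  move=> /andP[s0 s1] [pX tX] [pY tY]; split.
    by apply: psdmxD; apply: psdmxZ => //; rewrite subr_ge0.
  by rewrite mxtraceD !mxtraceZ tX tY !mulr1 -rmorphD subrK.
have [pG G0 trG] := hG.1.
have defG : diag_defect G = 0 by rewrite /diag_defect G0 subrr.
pose G2 : blockmx R d n := 2^-1%:C *: G.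
have SG : S G2.
  split; first by apply: psdmxZ => //; rewrite invr_ge0.
  rewrite mxtraceZ diag_defect_trace defG trG mxtrace0 subr0.
  by rewrite -(rmorph_nat (real_complex R)) -rmorphM mulVf ?pnatr_eq0.
have [M M0 perturb] := dual_value_perturbation k0 hG (ltW vc').
rewrite -/v in perturb.
(* If b X X < k^2, then |tau X| <= k and the entries of E(X) are at most k, so its
   entrywise 1-norm is at most d^2 k; the perturbation bound then reads
   (c' - v) / 2 <= k + d^2 k M, which this k violates. *)
pose k := (c' - v) / 2 / (2 + d%:R * d%:R * M).
have den_gt0 : 0 < 2 + d%:R * d%:R * M.
  by apply: ltr_wpDr => //; rewrite !mulr_ge0 ?ler0n.
have k_gt0 : 0 < k by rewrite /k !divr_gt0 ?subr_gt0.
have kE : k * (2 + d%:R * d%:R * M) = (c' - v) / 2 by rewrite /k divfK ?gt_eqF.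
have b_ge X : S X -> k ^+ 2 <= b X X.
  move=> [pX tX]; rewrite leNgt; apply/negP => b_lt.
  have hs_le : re_hs (diag_defect X) (diag_defect X) <= k ^+ 2.
    by apply: le_trans (ltW b_lt); rewrite lerDl -expr2 sqr_ge0.
  have tau_le : tau X ^+ 2 <= k ^+ 2.
    by apply: le_trans (ltW b_lt); rewrite expr2 lerDr re_hs_ge0.
  rewrite -lecR re_hs_mxE in hs_le.
  have := perturb _ _ pX tX (entry_norm1_le (ltW k_gt0) hs_le); rewrite -DE -/(tau X).
  move: tau_le; rewrite -[leLHS]real_normK ?num_real //.
  rewrite ler_pXn2r ?nnegrE ?(ltW k_gt0) //.
  rewrite ler_norml => /andP[tau_ge _].
  clearbody k; lra.
pose N := re (entry_norm1 D).
have NE : entry_norm1 D = N%:C by rewrite /N RRe_real // ger0_real // entry_norm1_ge0.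
pose K := d%:R * d%:R * n.+1%:R ^+ 2 + N * N.
have b_le X : S X -> b X X <= K.
  move=> [pX tX]; rewrite lerD //.
    apply: re_hs_le => u w; rewrite rmorph_nat.
    by have := diag_defect_entry_le u w pX; rewrite tX mulr1.
  have := psdmx_trace_bound D pX; rewrite tX mulr1 NE => /normr_Re_le tauN.
  rewrite -expr2 -[leLHS]real_normK ?num_real // -expr2 ler_pXn2r ?nnegrE //.
  exact: le_trans (normr_ge0 _) tauN.
have [|||w [[[hw pw] tw] w_sep]] :=
  @exists_separating_point R _ b S K (k ^+ 2) bC bD bZ Sconv.
- by exists G2.
- by rewrite exprn_gt0.
- by move=> X SX; rewrite b_ge // b_le.
have tauG : tau G = v - c' by rewrite /tau DE trG mulr1 ReD ReN /= -/v.
(* E(G) = 0, so only the second component of the image of G contributes. *)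
have t_lt0 : tau w < 0.
  have := w_sep _ SG; rewrite bC /G2 bZ {1}/b defG.
  rewrite re_hs0 add0r tauG.
  by rewrite pmulr_rgt0 ?invr_gt0 // nmulr_rgt0 // subr_lt0.
set t := tau w in t_lt0.
pose Z' : 'M[C]_d := t^-1%:C *: diag_defect w.
have /hermsymmxP hE := diag_defect_herm hw.
have hZ' : Z' \is hermsymmx.
  apply/hermsymmxP; rewrite /Z' linearZ /= map_mxZ hE /= conj_Creal //.
  by rewrite complex_real.
(* The separation extends from trace 1 to the whole cone by scaling. *)
have b_psd X : psdmx X -> 0 <= b w X.
  move=> pX; have trX_ge := psdmx_trace_ge0 pX.
  have [L XE] := psdmx_factor pX.
  have trXE : \tr X = (re (\tr X))%:C by rewrite RRe_real // ger0_real.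
  have [trX0|trX_neq] := eqVneq (re (\tr X)) 0.
    rewrite trX0 {1}XE in trXE; rewrite bC XE (mul_adjmx_eq0 trXE) mul0mx.
    by have := bD 0 0 w; rewrite addr0; lra.
  have trX_gt : 0 < re (\tr X) by rewrite lt0r trX_neq -ler0c -trXE.
  have SX : S ((re (\tr X))^-1%:C *: X).
    split; first by apply: psdmxZ => //; rewrite invr_ge0 ltW.
    by rewrite mxtraceZ trXE -rmorphM mulVf.
  by have := w_sep _ SX; rewrite bC bZ pmulr_rgt0 ?invr_gt0 // bC => /ltW.
have Z'_feasible : primal_feasible A c' Z'.
  split=> //; split; first exact: primal_mx_herm.
  move=> x; rewrite quadratic_form_trace; set X := x *m x^t*.
  have pX : psdmx X by apply: psdmx_mul_adj.
  have trR : \tr (primal_mx A c' Z' *m X) \is Num.real.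
    by apply: mxtrace_herm_real; [apply: primal_mx_herm | case: pX].
  rewrite -(RRe_real trR) ler0c lagrangian_identity -[X in X - _]opprB -DE.
  rewrite ReD ReN /Z' -scalemxAl mxtraceZ ReN ReZ -/(tau X).
  rewrite -[X in \tr (X *m _)]hE -/(re_hs _ _).
  have -> : - tau X - t^-1 * re_hs (diag_defect w) (diag_defect X) =
     - t^-1 * b w X.
    by rewrite /b -/t mulrDr [RHS]addrC !mulNr mulKf ?lt_eqF.
  by rewrite mulr_ge0 ?b_psd // oppr_ge0 invr_le0 ltW.
by have := cmin _ _ Z'_feasible; rewrite leNgt c'c.
Qed.
End Gap.

Theorem lemma4p6 (R : realType) (d n : nat) (hd : (0 < d)%N) (hn : (0 < n)%N)
    (A : 'I_n.+1 -> 'M[R[i]]_d) (hA : forall i, A i \is hermsymmx)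
    (c : R) (Z : 'M[R[i]]_d) (G : blockmx R d n)
    (hP : primal_optimal A c Z) (hD : dual_optimal A G) :
  [/\ forall j : 'I_n.+1,
        ((c%:C)%:M - A ord0 - Z) *m blk G ord0 j =
        - \sum_(i < n.+1 | i != ord0) A i *m blk G i j,
      forall i j : 'I_n.+1, i != ord0 ->
        Z *m blk G i j = - (A i *m blk G ord0 j)
    & Z *m blk G ord0 ord0 *m Z = Phi A (blk G ord0 ord0)].
Proof.
have [[hZ pM] _] := hP; have [[pG G0 trG] _] := hD.
have /hermsymmxP hG := pG.1.
have defG : diag_defect G = 0 by rewrite /diag_defect G0 subrr.
(* Without a duality gap, the primal matrix and G are orthogonal. *)
have [MG_ge0 MG_eq0] := psdmx_trace_mul pM pG.
have MG0 : primal_mx A c Z *m G = 0.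
  apply: MG_eq0; apply/eqP; rewrite eq_le MG_ge0 andbT.
  rewrite -(RRe_real (ger0_real MG_ge0)) -(rmorph0 (real_complex R)) lecR.
  rewrite lagrangian_identity trG defG mulmx0 mxtrace0 subr0 mulr1 ReD ReN /=.
  by rewrite subr_le0; apply: (strong_duality hA hn hP hD).
have rowE i j : \sum_k blk (primal_mx A c Z) i k *m blk G k j = 0.
  by rewrite -blkM MG0; apply: submxblock0.
have row0 (j : 'I_n.+1) : ((c%:C)%:M - A ord0 - Z) *m blk G ord0 j =
    - \sum_(i < n.+1 | i != ord0) A i *m blk G i j.
  apply/eqP; rewrite -addr_eq0 -[X in _ == X](rowE ord0 j).
  rewrite [X in _ == X](bigD1 ord0) //= blk_primal_mx eqxx; apply/eqP; congr (_ + _).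
  by apply: eq_bigr => i /negPf i0; rewrite blk_primal_mx eqxx i0.
have rowi (i j : 'I_n.+1) : i != ord0 ->
    Z *m blk G i j = - (A i *m blk G ord0 j).
  move=> i0; apply/eqP; rewrite -addr_eq0 -[X in _ == X](rowE i j).
  rewrite (bigD1 ord0) //= (bigD1 i) //= !blk_primal_mx eqxx (negPf i0).
  rewrite eqxx [X in _ + (_ + X)]big1 => [|k /andP[/negPf k0 /negPf ki]].
    by rewrite addr0 addrC.
  by rewrite blk_primal_mx (negPf i0) k0 eq_sym ki mul0mx.
split=> //.
rewrite {1}G0 mulmx_sumr mulmx_suml /Phi; apply: eq_bigr => i i0.
rewrite rowi // mulNmx -[in LHS]mulmxA.
have -> : blk G ord0 i *m Z = - (blk G ord0 ord0 *m A i).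
  have /hermsymmxP hZ' := hZ; have /hermsymmxP hAi := hA i.
  rewrite -[in LHS]hG blk_adj -[in LHS]hZ' -adjmxM rowi // linearN /= map_mxN.
  by rewrite adjmxM hAi -blk_adj hG.
by rewrite mulmxN opprK mulmxA.
Qed.
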